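(* Every digroup is isomorphic to a transformation digroup. That is, for every digroup $(G,\stackrel{\rightharpoonup}{\cdot},\stackrel{\leftharpoonup}{\cdot})$ there exist sets $\Delta$ (nonempty) and $\Gamma$, a subgroup $\mathcal{G}$ of the symmetric group $Sym\,\Gamma$, a group homomorphism $\theta:\mathcal{G}\to Sym\,\Delta$, and a subdigroup $H$ of the digroup $\ell_{\Delta\times\mathcal{G}}$ determined by $(\mathcal{G},\theta)$, such that $G$ is isomorphic to $H$ as a digroup.
   Context: **Digroup.** A nonempty set $G$ with two binary operations $\stackrel{\rightharpoonup}{\cdot}$ (left product) and $\stackrel{\leftharpoonup}{\cdot}$ (right product) is a digroup if: (i) for all $x,y,z\in G$: $x\stackrel{\rightharpoonup}{\cdot}(y\stackrel{\rightharpoonup}{\cdot}z)=(x\stackrel{\rightharpoonup}{\cdot}y)\stackrel{\rightharpoonup}{\cdot}z=x\stackrel{\rightharpoonup}{\cdot}(y\stackrel{\leftharpoonup}{\cdot}z)$, $(x\stackrel{\leftharpoonup}{\cdot}y)\stackrel{\rightharpoonup}{\cdot}z=x\stackrel{\leftharpoonup}{\cdot}(y\stackrel{\rightharpoonup}{\cdot}z)$, $(x\stackrel{\rightharpoonup}{\cdot}y)\stackrel{\leftharpoonup}{\cdot}z=(x\stackrel{\leftharpoonup}{\cdot}y)\stackrel{\leftharpoonup}{\cdot}z=x\stackrel{\leftharpoonup}{\cdot}(y\stackrel{\leftharpoonup}{\cdot}z)$; (ii) there is an element $e\in G$ (a bar-unit) with $x\stackrel{\rightharpoonup}{\cdot}e=x=e\stackrel{\leftharpoonup}{\cdot}x$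 for all $x\in G$; (iii) for each $x\in G$ there are elements $x_e^{\stackrel{\ell}{-}1},x_e^{\stackrel{r}{-}1}\in G$ with $x_e^{\stackrel{\ell}{-}1}\stackrel{\rightharpoonup}{\cdot}x=e=x\stackrel{\leftharpoonup}{\cdot}x_e^{\stackrel{r}{-}1}$. **Halo.** $\hbar(G)$ is the set of all bar-units of $G$, i.e. all $\alpha\in G$ with $x\stackrel{\rightharpoonup}{\cdot}\alpha=x=\alpha\stackrel{\leftharpoonup}{\cdot}x$ for all $x\in G$. **Subdigroup.** A subset $H$ of a digroup $G$ is a subdigroup if $H\cap\hbar(G)\neq\emptyset$ and $H$ is itself a digroup under the two operations of $G$. **Isomorphism.** A bijection $\varphi:G\to\bar G$ between digroups with $\varphi(x*y)=\varphi(x)*\varphi(y)$ for all $x,y\in G$ and both $*=\stackrel{\rightharpoonup}{\cdot},\stackrel{\leftharpoonup}{\cdot}$. **The digroup $\ell_{\Delta\times\mathcal{G}}$ and transformation digroups.** Let $\Delta,\Gamma$ be sets with $\Delta$ nonempty, $\mathcal{G}$ a subgroup of $Sym\,\Gamma$ (product is composition, $(fg)(i)=f(g(i))$), and $\theta:\mathcal{G}\to Sym\,\Delta$ a group homomorphism. For $(s,f)\in\Delta\times Sym\,\Gamma$ let $\ell_{s,f}:\Delta\times\Gamma\to\Delta\times\Gamma$ be the map $\ell_{s,f}(k,i)=(s,f(i))$. Put $\ell_{\Delta\times\mathcal{G}}=\{\ell_{s,f}\mid (s,f)\in\Delta\times\mathcal{G}\}$. It is a digroup under $\ell_{s,f}\stackrel{\rightharpoonup}{\cdot}\ell_{t,g}=\ell_{s,fg}$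 and $\ell_{s,f}\stackrel{\leftharpoonup}{\cdot}\ell_{t,g}=\ell_{\theta(f)(t),fg}$. A subdigroup of $\ell_{\Delta\times\mathcal{G}}$ is called a transformation digroup on $\Delta\times\Gamma$ induced by $(\mathcal{G},\theta)$. *)

(* Defs.v *)
From HB Require Import structures.
From mathcomp Require Import all_boot.
From mathcomp Require Import boolp classical_sets.

Set Implicit Arguments.
Unset Strict Implicit.
Unset Printing Implicit Defensive.

Declare Scope digroup_scope.
Delimit Scope digroup_scope with dg.
Local Open Scope group_scope.
Local Open Scope classical_set_scope.
Local Open Scope digroup_scope.

Section DigroupAxioms.
Variables (G : Type) (l r : G -> G -> G).

Definition bar_unit (e : G) : Prop := forall x, l x e = x /\ r e x = x.

(* The inverses are taken with respect to the bar-unit [e], and the left and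
   the right inverse of an element may differ.  Nonemptiness is implied. *)
Record digroup_axioms : Prop := DigroupAxioms {
  ax_lA : forall x y z, l x (l y z) = l (l x y) z;
  ax_lr : forall x y z, l (l x y) z = l x (r y z);
  ax_rl : forall x y z, l (r x y) z = r x (l y z);
  ax_lrr : forall x y z, r (l x y) z = r (r x y) z;
  ax_rA : forall x y z, r (r x y) z = r x (r y z);
  ax_unit_inv : exists e, bar_unit e /\
    forall x, (exists y, l y x = e) /\ (exists y, r x y = e) }.

End DigroupAxioms.

HB.mixin Record isDigroup (G : Type) := {
  lprod : G -> G -> G;
  rprod : G -> G -> G;
  digroupP : digroup_axioms lprod rprod }.

#[short(type="digroupType")]
HB.structure Definition Digroup := {G of isDigroup G}.

Bind Scope digroup_scope with Digroup.sort.
Notation "x ⇀ y" := (lprod x y) (at level 40, left associativity)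
  : digroup_scope.
Notation "x ↼ y" := (rprod x y) (at level 40, left associativity)
  : digroup_scope.

Definition halo (G : digroupType) : set G :=
  [set e | bar_unit (@lprod G) (@rprod G) e].

Definition op_closed (T : Type) (op : T -> T -> T) (H : set T) : Prop :=
  forall x y, H x -> H y -> H (op x y).

Definition restrict_op (T : Type) (op : T -> T -> T) (H : set T)
    (clH : op_closed op H) (x y : H) : H :=
  SigSub (mem_set (clH _ _ (set_mem (valP x)) (set_mem (valP y)))).

Record subdigroup (G : digroupType) (H : set G) : Prop := Subdigroup {
  subdigroup_halo : H `&` @halo G !=set0;
  subdigroup_l : op_closed (@lprod G) H;
  subdigroup_r : op_closed (@rprod G) H;
  subdigroupP :
    digroup_axioms (restrict_op subdigroup_l) (restrict_op subdigroup_r) }.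

Definition subdigroup_digroup (G : digroupType) (H : set G)
    (sH : subdigroup H) : digroupType :=
  HB.pack (set_type H) (isDigroup.Build (set_type H) (subdigroupP sH)).

Definition digroup_isomorphic (G K : digroupType) : Prop :=
  exists phi : G -> K, [/\ bijective phi,
    {morph phi : x y / x ⇀ y} & {morph phi : x y / x ↼ y}].

(* The symmetric group on an arbitrary, possibly infinite, type. *)
Definition Sym (T : Type) : Type := {f : T -> T | bijective f}.

Definition Sym_fun (T : Type) (f : Sym T) : T -> T := sval f.
Coercion Sym_fun : Sym >-> Funclass.

Lemma SymP (T : Type) (f g : Sym T) : (forall i, f i = g i) -> f = g.
Proof.
case: f g => [f fb] [g gb] /= fg; have /funext {}fg : f =1 g by [].
by case: _ / fg in gb *; congr exist; exact: Prop_irrelevance.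
Qed.

Section SymGroup.
Variable T : Type.
Implicit Types f g h : Sym T.

Definition Sym_one : Sym T :=
  exist _ id (Bijective (fun=> erefl) (fun=> erefl)).

Definition Sym_mul f g : Sym T :=
  exist _ (f \o g) (bij_comp (svalP f) (svalP g)).

Lemma Sym_inv_subproof f : {g : Sym T | cancel f g & cancel g f}.
Proof.
apply: cid2; case: f => f [g fK gK] /=.
by exists (exist _ g (Bijective gK fK)).
Qed.

Definition Sym_inv f : Sym T := s2val (Sym_inv_subproof f).

Lemma Sym_mulA : associative Sym_mul.
Proof. by move=> f g h; apply: SymP. Qed.
Lemma Sym_mul1 : left_id Sym_one Sym_mul.
Proof. by move=> f; apply: SymP. Qed.
Lemma Sym_mulr1 : right_id Sym_one Sym_mul.
Proof. by move=> f; apply: SymP. Qed.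
Lemma Sym_mulV : left_inverse Sym_one Sym_inv Sym_mul.
Proof.
by move=> f; apply: SymP => i; exact: (s2valP (Sym_inv_subproof f)).
Qed.
Lemma Sym_mulrV : right_inverse Sym_one Sym_inv Sym_mul.
Proof.
by move=> f; apply: SymP => i; exact: (s2valP' (Sym_inv_subproof f)).
Qed.

HB.instance Definition _ := gen_eqMixin (Sym T).
HB.instance Definition _ := gen_choiceMixin (Sym T).
HB.instance Definition _ := isGroup.Build (Sym T)
  Sym_mulA Sym_mul1 Sym_mulr1 Sym_mulV Sym_mulrV.

End SymGroup.

(* The group carried by a subgroup of a possibly infinite group. *)
Section SubgroupGroup.
Variables (G : groupType) (S : groupClosed G).

Definition subgroup_of : Type := {x : G | x \in S}.

HB.instance Definition _ := SubChoice.on subgroup_of.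

Lemma subgroup_of_subproof : group_closed S.
Proof. by split; [exact: gpred1 | exact: gpredF]. Qed.

HB.instance Definition _ :=
  SubChoice_isSubGroup.Build G (mem S) subgroup_of subgroup_of_subproof.

End SubgroupGroup.

Section Ell.
Variables (Delta : pointedType) (Gamma : Type) (S : groupClosed (Sym Gamma)).
Variable theta : UMagmaMorphism.type (subgroup_of S) (Sym Delta).
Implicit Types (s t : Delta) (f g : subgroup_of S).

Definition ell (s : Delta) (f : Sym Gamma) (p : Delta * Gamma) : Delta * Gamma :=
  (s, f p.2).

Definition ell_set : set (Delta * Gamma -> Delta * Gamma) :=
  [set F | exists s f, F = ell s (val f)].

(* [theta] does not affect the underlying set of maps, only [rprod]. *)
Definition ell_digroup
    of UMagmaMorphism.type (subgroup_of S) (Sym Delta) : Type := ell_set.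

Local Notation L := (ell_digroup theta).

Lemma Ell_subproof s f : ell s (val f) \in ell_set.
Proof. by apply/mem_set; exists s, f. Qed.

Definition Ell s f : L := SigSub (Ell_subproof s f).

Lemma ell_rep_subproof (a : L) :
  {sf : Delta * subgroup_of S | a = Ell sf.1 sf.2}.
Proof.
apply: cid; case: a => F aF; have [s [f eF]] := set_mem aF.
by exists (s, f); apply: val_inj; rewrite /= eF.
Qed.

Definition ell_pt (a : L) : Delta := (sval (ell_rep_subproof a)).1.
Definition ell_perm (a : L) : subgroup_of S := (sval (ell_rep_subproof a)).2.

Lemma ell_repK (a : L) : Ell (ell_pt a) (ell_perm a) = a.
Proof. by rewrite /ell_pt /ell_perm; case: ell_rep_subproof. Qed.

(* The products are computed on a chosen pair representing each map. A map
   determines its pair unless [Gamma] is empty, in which case there is only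
   one map; see [ell_lprodE] and [ell_rprodE]. *)
Definition ell_lprod (a b : L) : L :=
  Ell (ell_pt a) (ell_perm a * ell_perm b).
Definition ell_rprod (a b : L) : L :=
  Ell (Sym_fun (theta (ell_perm a)) (ell_pt b)) (ell_perm a * ell_perm b).

Lemma Ell_inj s t f g : inhabited Gamma -> Ell s f = Ell t g -> s = t /\ f = g.
Proof.
move=> [i0] /(congr1 val) /= e; split.
  by have /(congr1 fst) := congr1 (@^~ (s, i0)) e.
by apply/val_inj/SymP => i; have /(congr1 snd) := congr1 (@^~ (s, i)) e.
Qed.

Lemma Ell_empty (a b : L) : ~ inhabited Gamma -> a = b.
Proof. by move=> hG; apply/val_inj/funext => -[s i]; case: hG. Qed.

Lemma ell_lprodE s t f g : ell_lprod (Ell s f) (Ell t g) = Ell s (f * g).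
Proof.
have [hG|hG] := pselect (inhabited Gamma); last exact: Ell_empty.
rewrite /ell_lprod.
have [-> ->] := Ell_inj hG (ell_repK (Ell s f)).
by have [_ ->] := Ell_inj hG (ell_repK (Ell t g)).
Qed.

Lemma ell_rprodE s t f g :
  ell_rprod (Ell s f) (Ell t g) = Ell (Sym_fun (theta f) t) (f * g).
Proof.
have [hG|hG] := pselect (inhabited Gamma); last exact: Ell_empty.
rewrite /ell_rprod.
have [_ ->] := Ell_inj hG (ell_repK (Ell s f)).
by have [-> ->] := Ell_inj hG (ell_repK (Ell t g)).
Qed.

Lemma ell_digroupP : digroup_axioms ell_lprod ell_rprod.
Proof.
have EllP (P : L -> Prop) : (forall s f, P (Ell s f)) -> forall a, P a.
  by move=> h a; rewrite -(ell_repK a).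
have th f g t :
    Sym_fun (theta (f * g)) t = Sym_fun (theta f) (Sym_fun (theta g) t).
  by rewrite gmulfM.
have th1 t : Sym_fun (theta 1) t = t by rewrite gmulf1.
split; last first.
  exists (Ell point 1); split; elim/EllP => s f.
    by rewrite ell_lprodE ell_rprodE mulg1 mul1g th1.
  split; first by exists (Ell point f^-1); rewrite ell_lprodE mulVg.
  exists (Ell (Sym_fun (theta f^-1) point) f^-1).
  by rewrite ell_rprodE -th mulgV th1.
all: elim/EllP => s f; elim/EllP => t g; elim/EllP => u h.
all: by rewrite ?(ell_lprodE, ell_rprodE) ?th ?mulgA.
Qed.

HB.instance Definition _ := isDigroup.Build L ell_digroupP.

End Ell.

(* Main.v *)
Require Import Defs.
From HB Require Import structures.
From mathcomp Require Import all_boot.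
From mathcomp Require Import boolp classical_sets.

Set Implicit Arguments.
Unset Strict Implicit.
Unset Printing Implicit Defensive.

Local Open Scope group_scope.
Local Open Scope classical_set_scope.
Local Open Scope digroup_scope.

(** This is a Cayley theorem.  For a digroup [G] write [R_x] for the map
    [z |-> x ↼ z].  The axioms say that [x |-> R_x] turns both products into
    composition, and that bar-units act as the identity; since every [x] has
    a left and a right inverse, [R_x] is a permutation of [G].  This loses the
    position of [x] in the halo, which is recovered from the set
    [x ⇀ G = {x ⇀ z | z in G}]: because the [R_y] are onto, [(x ⇀ y) ⇀ G]
    equals [x ⇀ G], while [(x ↼ y) ⇀ G] is the direct image [R_x (y ⇀ G)].
    These are exactly the rules for the first coordinate in the digroup of
    maps [ell s f] when the permutations of [G] act on the subsets of [G] by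
    direct image.  So [Gamma = G], [Delta] is the power set of [G], the group
    is all of [Sym G], the homomorphism [theta] is direct image, and
    [x |-> ell (x ⇀ G) R_x] is the embedding ([cayley_morph_l],
    [cayley_morph_r]).  It is injective: if [x] and [y] have the same image,
    then [x = y ⇀ z] with [R_z] the identity, and such a [z] acts on the right
    of [⇀] as a bar-unit, so [x = y] ([range_rtrans_inj]).  The bar-units are
    the idempotents of [↼], so morphisms preserve them; hence the range of the
    embedding is a subdigroup ([range_subdigroup]), isomorphic to [G]
    ([range_isomorphic]). *)

(** * Right products as permutations *)

Section RightProduct.
Variable G : digroupType.
Implicit Types x p : G.

(** A left inverse and a right inverse of [x] give a left and a right inverse
    of this map, since the map of a bar-unit is the identity and both products
    of elements become composition of maps. *)
Lemma rprod_bijective x : bijective (rprod x).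
Proof.
have [_ _ _ lrr rA [e [e_unit e_inv]]] := @digroupP G.
have rE z : e ↼ z = z by have [] := e_unit z.
have [[u ux] [v xv]] := e_inv x.
have uK z : u ↼ (x ↼ z) = z by rewrite -rA -lrr ux rE.
have vK z : x ↼ (v ↼ z) = z by rewrite -rA xv rE.
(* The two inverses coincide. *)
by exists (rprod u) => // z; rewrite -{1}(vK z) uK vK.
Qed.

(** Injectivity of [rprod p] turns [p ↼ (p ↼ x) = p ↼ x] into [p ↼ x = x].
    With [p ↼ e = e] for a bar-unit [e], the other unit law follows from
    [x ⇀ p = (x ⇀ p) ⇀ e = x ⇀ (p ↼ e)]. *)
Lemma idempotent_halo p : p ↼ p = p -> halo p.
Proof.
move=> pp; have [_ lr _ _ rA [e [e_unit _]]] := @digroupP G.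
have lE x : x ⇀ e = x by have [] := e_unit x.
have p1 x : p ↼ x = x by apply: (bij_inj (rprod_bijective p)); rewrite -rA pp.
by move=> x; split; rewrite // -[LHS]lE lr p1 lE.
Qed.

End RightProduct.

(** * Ranges of digroup morphisms *)

Section Range.
Variables (G K : digroupType) (phi : G -> K).
Hypothesis phi_l : {morph phi : x y / x ⇀ y}.
Hypothesis phi_r : {morph phi : x y / x ↼ y}.

Lemma range_closed_l : op_closed (@lprod K) (range phi).
Proof. by move=> _ _ [x _ <-] [y _ <-]; exists (x ⇀ y). Qed.

Lemma range_closed_r : op_closed (@rprod K) (range phi).
Proof. by move=> _ _ [x _ <-] [y _ <-]; exists (x ↼ y). Qed.

(** A bar-unit [e] is idempotent, hence so is [phi e], which is therefore a
    bar-unit; the images of inverses are inverses for it. *)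
Lemma range_subdigroup : subdigroup (range phi).
Proof.
have [_ _ _ _ _ [e [e_unit e_inv]]] := @digroupP G.
have phie_unit : halo (phi e).
  by apply: idempotent_halo; rewrite -phi_r; have [_ ->] := e_unit e.
have in_range x : phi x \in range phi by apply/mem_set; exists x.
exists range_closed_l range_closed_r.
  by exists (phi e); split => //; exists e.
have [lA lr rl lrr rA _] := @digroupP K.
split; try by move=> x y z; apply: val_inj => /=.
exists (SigSub (in_range e)); split.
  by move=> x; split; apply: val_inj; have [] := phie_unit (val x).
move=> [y yR]; have [x _ xy] := set_mem yR.
have [[u ux] [v xv]] := e_inv x; split.
  by exists (SigSub (in_range u)); apply: val_inj; rewrite /= -xy -phi_l ux.
by exists (SigSub (in_range v)); apply: val_inj; rewrite /= -xy -phi_r xv.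
Qed.

Lemma range_isomorphic (sR : subdigroup (range phi)) :
  injective phi -> digroup_isomorphic G (subdigroup_digroup sR).
Proof.
move=> phi_inj.
have in_range x : phi x \in range phi by apply/mem_set; exists x.
have preimage (y : range phi) : {x | phi x = val y}.
  by apply: cid; have [x _ <-] := set_mem (valP y); exists x.
exists (fun x => SigSub (in_range x)); split.
- exists (fun y => sval (preimage y)) => [x|y].
    by apply: phi_inj; case: (preimage _).
  by apply: val_inj; case: (preimage y).
- by move=> x y; apply: val_inj; rewrite /= phi_l.
- by move=> x y; apply: val_inj; rewrite /= phi_r.
Qed.

End Range.

(** * Permutation groups acting on subsets *)

Definition full_sym (T : Type) : {pred Sym T} := predT.
Arguments full_sym : clear implicits.

Section FullSym.
Variable T : Type.

Lemma full_symV : invg_closed (full_sym T). Proof. by []. Qed.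
Lemma full_sym1 : 1 \in full_sym T. Proof. by []. Qed.
Lemma full_symM : mulg_closed (full_sym T). Proof. by []. Qed.

Definition full_group : groupClosed (Sym T) :=
  HB.pack (full_sym T)
    (isInvClosed.Build (Sym T) (full_sym T) full_symV)
    (isMul1Closed.Build (Sym T) (full_sym T) full_sym1)
    (isMulClosed.Build (Sym T) (full_sym T) full_symM).

Local Notation S := (subgroup_of full_group).

Definition in_full (f : Sym T) : S := exist _ f (isT : f \in full_group).

Lemma image_bijective (f : Sym T) : bijective (fun A : set T => f @` A).
Proof.
case: f => f [g fK gK]; exists (fun A => g @` A) => A /=.
  by rewrite image_comp -[RHS]image_id; apply: eq_imagel => i _ /=.
by rewrite image_comp -[RHS]image_id; apply: eq_imagel => i _ /=.
Qed.

Definition image_action (f : S) : Sym (set T) :=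
  exist _ _ (image_bijective (val f)).

Lemma image_action1 : image_action 1 = 1.
Proof. by apply: SymP => A; exact: image_id. Qed.

Lemma image_actionM : {morph image_action : f g / f * g}.
Proof. by move=> f g; apply: SymP => A; rewrite /= image_comp. Qed.

HB.instance Definition _ := isUMagmaMorphism.Build S (Sym (set T))
  image_action (image_action1, image_actionM).

End FullSym.

(** * The Cayley embedding *)

Section Cayley.
Variable G : digroupType.
Implicit Types x y z : G.

Definition rtrans x : Sym G := exist _ _ (rprod_bijective x).

Lemma rtrans_l x y : rtrans (x ⇀ y) = rtrans x * rtrans y.
Proof.
have [_ _ _ lrr rA _] := @digroupP G.
by apply: SymP => z /=; rewrite lrr rA.
Qed.

Lemma rtrans_r x y : rtrans (x ↼ y) = rtrans x * rtrans y.
Proof.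
have [_ _ _ _ rA _] := @digroupP G.
by apply: SymP => z /=; rewrite rA.
Qed.

(** The maps of [x ⇀ y] and [x] differ by precomposition with [rprod y],
    which is onto. *)
Lemma range_lprod_l x y : range (lprod (x ⇀ y)) = range (lprod x).
Proof.
have [_ lr _ _ _ _] := @digroupP G.
apply/seteqP; split=> _ [z _ <-]; first by exists (y ↼ z); rewrite ?lr.
have [g _ gK] := rprod_bijective y.
by exists (g z) => //; rewrite lr gK.
Qed.

Lemma range_lprod_r x y : range (lprod (x ↼ y)) = rprod x @` range (lprod y).
Proof.
have [_ _ rl _ _ _] := @digroupP G.
by rewrite image_comp; apply: eq_imagel => z _; rewrite rl.
Qed.

(** A bar-unit [e] gives [x = x ⇀ e], so [x] lies in [y ⇀ G], say
    [x = y ⇀ z]; equality of the permutations then forces that of [z] to be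
    the identity, whence [y ⇀ z = y ⇀ (z ↼ e) = y ⇀ e = y]. *)
Lemma range_rtrans_inj x y :
  range (lprod x) = range (lprod y) -> rtrans x = rtrans y -> x = y.
Proof.
have [lA lr _ _ _ [e [e_unit _]]] := @digroupP G.
have lE z : z ⇀ e = z by have [] := e_unit z.
move=> xy_range; have : range (lprod y) x.
  by rewrite -xy_range; exists e; rewrite ?lE.
move=> [z _ <-]; rewrite rtrans_l => yz_perm.
have z1 : rtrans z = 1 by apply: (mulgI (rtrans y)); rewrite yz_perm mulg1.
have ze : z ↼ e = e by rewrite -[LHS]/(rtrans z e) z1.
by rewrite -[LHS]lE lr ze lE.
Qed.

Definition cayley x : ell_digroup (@image_action G) :=
  Ell (@image_action G) (range (lprod x)) (in_full (rtrans x)).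

Lemma in_fullM (f g : Sym G) : in_full (f * g) = in_full f * in_full g.
Proof. exact: val_inj. Qed.

Lemma cayley_morph_l : {morph cayley : x y / x ⇀ y}.
Proof.
move=> x y; rewrite [RHS]ell_lprodE -in_fullM.
by rewrite /cayley range_lprod_l rtrans_l.
Qed.

Lemma cayley_morph_r : {morph cayley : x y / x ↼ y}.
Proof.
move=> x y; rewrite [RHS]ell_rprodE -in_fullM.
by rewrite /cayley range_lprod_r rtrans_r.
Qed.

Lemma cayley_inj : injective cayley.
Proof.
move=> x y /(Ell_inj (inhabits x)) [xy_range /(congr1 val) xy_perm].
exact: range_rtrans_inj.
Qed.

End Cayley.

Theorem proposition3p3 :
  forall G : digroupType,
  exists (Delta : pointedType) (Gamma : Type)
    (S : groupClosed (Sym Gamma))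
    (theta : UMagmaMorphism.type (subgroup_of S) (Sym Delta))
    (H : set (ell_digroup theta))
    (sH : subdigroup H),
  digroup_isomorphic G (subdigroup_digroup sH).
Proof.
move=> G; exists (set G), G, (full_group G), (@image_action G).
exists (range (@cayley G)).
exists (range_subdigroup (@cayley_morph_l G) (@cayley_morph_r G)).
exact: (range_isomorphic (@cayley_morph_l G) (@cayley_morph_r G) _
  (@cayley_inj G)).
Qed.
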